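(* For $a\in(0,1)$ let $\Gamma_a=\{(x,F_a(x)):x\in[0,1]\}\subset\mathbb{R}^2$ be the graph of $F_a$. Then the Hausdorff dimension of $\Gamma_a$ satisfies $\dim_H(\Gamma_a)=1$ for all $a\in(0,1/2]$.
   Context: For $a\in(0,1)$ the function $F_a:[0,1]\to[0,1]$ is defined as follows. Define continuous functions $f_i:[0,1]\to[0,1]$, $i\ge 0$, inductively: $f_0(x)=x$ for all $x\in[0,1]$; each $f_i$ is continuous on $[0,1]$ and affine on each subinterval $[k/3^i,(k+1)/3^i]$, $k\in\{0,1,\ldots,3^i-1\}$; and for all $i\ge 0$ and $k\in\{0,1,\ldots,3^i-1\}$, $$f_{i+1}\left(\frac{k}{3^i}\right)=f_i\left(\frac{k}{3^i}\right),\qquad f_{i+1}\left(\frac{3k+1}{3^{i+1}}\right)=f_i\left(\frac{k}{3^i}\right)+a\left[f_i\left(\frac{k+1}{3^i}\right)-f_i\left(\frac{k}{3^i}\right)\right],$$ $$f_{i+1}\left(\frac{3k+2}{3^{i+1}}\right)=f_i\left(\frac{k}{3^i}\right)+(1-a)\left[f_i\left(\frac{k+1}{3^i}\right)-f_i\left(\frac{k}{3^i}\right)\right],\qquad f_{i+1}\left(\frac{k+1}{3^i}\right)=f_i\left(\frac{k+1}{3^i}\right).$$ Then $F_a=\lim_{i\to\infty}f_i$. *)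

(* Defs.v *)
From mathcomp Require Import all_boot all_order all_algebra.
From mathcomp Require Import all_classical all_reals all_analysis.

Set Implicit Arguments.
Unset Strict Implicit.
Unset Printing Implicit Defensive.

Import Order.TTheory GRing.Theory Num.Theory.
Import numFieldNormedType.Exports.

Local Open Scope classical_set_scope.
Local Open Scope ring_scope.

Section HausdorffDimension.
Context {R : realType} {T : Type}.
Variable d : T -> T -> R.
Local Open Scope ereal_scope.

(* Meaningful for nonempty sets only: [ereal_sup set0] is -oo. *)
Definition diam (U : set T) : \bar R :=
  ereal_sup [set (d p.1 p.2)%:E | p in U `*` U].

(* The empty set contributes 0 for every s, while a nonempty set of diameter 0
   contributes 0 `^ 0 = 1 when s = 0, so that the 0-dimensional measure counts
   points. *)
Definition diam_pow (s : R) (U : set T) : \bar R :=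
  if `[< U = set0 >] then 0 else diam U `^ s.

(* Finite covers are included, since the U i may be empty. *)
Definition hausdorff_content (s delta : R) (A : set T) : \bar R :=
  ereal_inf [set \sum_(0 <= i <oo) diam_pow s (U i) | U in
    [set U : nat -> set T | A `<=` \bigcup_i U i /\
                            forall i, diam (U i) <= delta%:E]].

(* The content is nonincreasing in delta, hence its limit as delta tends to 0
   from above is a supremum. *)
Definition hausdorff_measure (s : R) (A : set T) : \bar R :=
  ereal_sup [set hausdorff_content s delta A |
              delta in [set delta : R | (0 < delta)%R]].

Definition hausdorff_dim (A : set T) : \bar R :=
  ereal_inf [set s%:E | s in
    [set s : R | (0 <= s)%R /\ hausdorff_measure s A = 0]].

End HausdorffDimension.

(* The library norm on R * R is the sup norm. *)
Definition euclid_dist {R : realType} (p q : R * R) : R :=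
  Num.sqrt ((p.1 - q.1) ^+ 2 + (p.2 - q.2) ^+ 2).

Section OkamotoFunction.
Context {R : realType}.
Variable a : R.

(* [okamoto_node i k] is the value of f_i at k / 3 ^ i, see [okamoto_f_node]. *)
Fixpoint okamoto_node (i k : nat) : R :=
  if i is j.+1 then
    let u := okamoto_node j (k %/ 3) in
    let v := okamoto_node j (k %/ 3).+1 in
    match (k %% 3)%N with
    | 0%N => u
    | 1%N => u + a * (v - u)
    | _ => u + (1 - a) * (v - u)
    end
  else k%:R.

Definition okamoto_f (i : nat) (x : R) : R :=
  let k := Num.truncn (3 ^+ i * x) in
  okamoto_node i k +
  (3 ^+ i * x - k%:R) * (okamoto_node i k.+1 - okamoto_node i k).

Definition okamoto_F (x : R) : R := lim (okamoto_f i x @[i --> \oo]).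

Definition okamoto_graph : set (R * R) :=
  [set (x, okamoto_F x) | x in `[0, 1]].

Lemma pow3_gt0 i : 0 < 3 ^+ i :> R.
Proof. by rewrite exprn_gt0. Qed.

Lemma okamoto_f_node i k : okamoto_f i (k%:R / 3 ^+ i) = okamoto_node i k.
Proof.
rewrite /okamoto_f mulrC divfK ?gt_eqF ?pow3_gt0//.
by rewrite natrK subrr mul0r addr0.
Qed.

Lemma okamoto_f0 x : 0 <= x -> okamoto_f 0 x = x.
Proof.
move=> x0; by rewrite /okamoto_f /= expr0 mul1r -natr1 addrAC
  subrr add0r mulr1 addrC subrK.
Qed.

Lemma okamoto_f_rec0 i k :
  okamoto_f i.+1 (k%:R / 3 ^+ i) = okamoto_f i (k%:R / 3 ^+ i).
Proof.
have -> : k%:R / 3 ^+ i = (3 * k)%:R / 3 ^+ i.+1 :> R.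
  by rewrite exprS natrM invfM mulrACA divff// mul1r.
by rewrite okamoto_f_node /= mulKn// modnMr -okamoto_f_node natrM exprS
  invfM mulrACA divff// mul1r.
Qed.

Lemma okamoto_f_rec1 i k : okamoto_f i.+1 ((3 * k + 1)%:R / 3 ^+ i.+1) =
  okamoto_f i (k%:R / 3 ^+ i) +
  a * (okamoto_f i (k.+1%:R / 3 ^+ i) - okamoto_f i (k%:R / 3 ^+ i)).
Proof. by rewrite !okamoto_f_node /= mulnC divnMDl// modnMDl addn0. Qed.

Lemma okamoto_f_rec2 i k : okamoto_f i.+1 ((3 * k + 2)%:R / 3 ^+ i.+1) =
  okamoto_f i (k%:R / 3 ^+ i) +
  (1 - a) * (okamoto_f i (k.+1%:R / 3 ^+ i) - okamoto_f i (k%:R / 3 ^+ i)).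
Proof. by rewrite !okamoto_f_node /= mulnC divnMDl// modnMDl addn0. Qed.

Lemma okamoto_f_affine i k x : x \in `[k%:R / 3 ^+ i, k.+1%:R / 3 ^+ i] ->
  okamoto_f i x =
  okamoto_f i (k%:R / 3 ^+ i) + (3 ^+ i * x - k%:R) *
    (okamoto_f i (k.+1%:R / 3 ^+ i) - okamoto_f i (k%:R / 3 ^+ i)).
Proof.
rewrite in_itv/= => /andP[kx]; rewrite le_eqVlt => /predU1P[->|xk].
  rewrite (mulrC _ (_ / _)) divfK ?gt_eqF ?pow3_gt0//.
  by rewrite -[X in X - _]natr1 (addrC _ 1) addrK mul1r addrC subrK.
rewrite !okamoto_f_node /okamoto_f; suff -> : Num.truncn (3 ^+ i * x) = k by [].
apply/eqP; rewrite truncn_eq; last first.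
  by rewrite mulr_ge0 ?(le_trans _ kx) ?divr_ge0 ?exprn_ge0.
by rewrite mulrC -ler_pdivrMr ?pow3_gt0// kx -ltr_pdivlMr ?pow3_gt0.
Qed.

Lemma okamoto_f_continuous i : {within `[0, 1], continuous (okamoto_f i)}.
Proof.
have H n : {within `[0, n%:R / 3 ^+ i], continuous (okamoto_f i)}.
  elim: n => [|n IH]; first by
    rewrite mul0r set_itv1; exact: continuous_subspace1.
  have -> : `[0, n.+1%:R / 3 ^+ i]%classic =
     `[0, n%:R / 3 ^+ i] `|` `[n%:R / 3 ^+ i, n.+1%:R / 3 ^+ i] :> set R.
    apply/seteqP; split=> x; rewrite /= !in_itv/=.
      move=> /andP[x0 xn]; have [|/ltW] := leP x (n%:R / 3 ^+ i).
        by left; rewrite x0.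
      by right; apply/andP.
    move=> [/andP[x0 xn]|/andP[nx xn]]; apply/andP; split=> //.
      by rewrite (le_trans xn)// ler_pM2r ?invr_gt0 ?pow3_gt0// ler_nat.
    by rewrite (le_trans _ nx)// divr_ge0 ?exprn_ge0.
  apply: withinU_continuous => //; [exact: interval_closed..|].
  pose g x := okamoto_f i (n%:R / 3 ^+ i) + (3 ^+ i * x - n%:R) *
    (okamoto_f i (n.+1%:R / 3 ^+ i) - okamoto_f i (n%:R / 3 ^+ i)).
  have gf : {in `[n%:R / 3 ^+ i, n.+1%:R / 3 ^+ i]%classic, g =1 okamoto_f i}.
    by move=> x; rewrite inE => xn; rewrite /g -okamoto_f_affine.
  apply: (subspace_eq_continuous gf).
  apply: continuous_subspaceT => x.
  apply: cvgD; first exact: cvg_cst.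
  apply: cvgM; last exact: cvg_cst.
  apply: cvgB; last exact: cvg_cst.
  by apply: cvgM; [exact: cvg_cst|exact: cvg_id].
by have := H (3 ^ i)%N; rewrite natrX divff// gt_eqF ?pow3_gt0.
Qed.

End OkamotoFunction.

(* Main.v *)
Require Import Defs.
From mathcomp Require Import all_boot all_order all_algebra.
From mathcomp Require Import all_classical all_reals all_analysis.
From mathcomp Require Import ring lra.

Import Order.TTheory GRing.Theory Num.Theory.
Import numFieldNormedType.Exports.
Local Open Scope ring_scope.

(** For [a <= 1/2] every increment of [f_i] is split into three nonnegative
parts, in proportions [a], [1 - 2 * a] and [a], so each [f_i], and hence the
limit [F], is nondecreasing. The graph of a nondecreasing function on the unit
interval has dimension 1 for two elementary reasons.

- Upper bound ([hausdorff_measure_graph01_eq0]). A nondecreasing graph is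
  parametrised by the coordinate [x + f x], and the inverse of this
  parametrisation is 1-Lipschitz, both [x] and [f x] being nondecreasing. Cutting
  the range of that coordinate into pieces of length [1 / N] cuts the graph into
  [O(N)] pieces of diameter at most [1 / N], and [N * N `^ (- s)] tends to 0
  for [s > 1].
- Lower bound ([hausdorff_content_graph01_ge]). The projection to the first axis
  is 1-Lipschitz and maps the graph onto the unit interval, so by countable
  subadditivity of Lebesgue measure the diameters of a cover cannot have a small
  sum; for [s <= 1] and diameters at most 1, their powers are even larger.

Monotonicity passes to [F] only once [f_i x] is known to converge. This is shown
by comparing [f_i x] with the value of [f_i] at the left end of the triadic
interval of [x] ([okamoto_F_lower]): these values are nondecreasing in [i] and
bounded, and they are within [(1 - a) ^+ i] of [f_i x]. *)

(** * Distance, diameter and content *)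

Definition graph01 {R : realType} (f : R -> R) : set (R * R) :=
  [set (x, f x) | x in `[0, 1]]%classic.

Lemma normB_le_euclid_dist {R : realType} (p q : R * R) :
  `|p.1 - q.1| <= euclid_dist p q.
Proof. by rewrite -sqrtr_sqr ler_wsqrtr// lerDl sqr_ge0. Qed.

Lemma euclid_dist_ge0 {R : realType} (p q : R * R) : 0 <= euclid_dist p q.
Proof. exact: sqrtr_ge0. Qed.

Lemma euclid_dist_le_add {R : realType} (p q : R * R) :
  euclid_dist p q <= `|p.1 - q.1| + `|p.2 - q.2|.
Proof.
have uv0 : 0 <= `|p.1 - q.1| + `|p.2 - q.2| by rewrite addr_ge0.
rewrite -(ger0_norm uv0) -sqrtr_sqr ler_wsqrtr// (sqrrD `|_|) !real_normK ?num_real//.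
by rewrite lerD2r lerDl mulrn_wge0// mulr_ge0.
Qed.

Lemma diam_ge0 {R : realType} {T : Type} (d : T -> T -> R) (U : set T) :
  (forall p q, 0 <= d p q) -> (U !=set0)%classic -> (0 <= diam d U)%E.
Proof.
move=> d0 [p Up]; apply: (@le_trans _ _ (d p p)%:E); first by rewrite lee_fin.
by apply: ereal_sup_ubound; exists (p, p).
Qed.

Lemma diam_pow_ge0 {R : realType} {T : Type} (d : T -> T -> R) s (U : set T) :
  (0 <= diam_pow d s U)%E.
Proof. by rewrite /diam_pow; case: asboolP => // _; exact: poweR_ge0. Qed.

Lemma hausdorff_content_ge0 {R : realType} {T : Type} (d : T -> T -> R)
  s delta (A : set T) : (0 <= hausdorff_content d s delta A)%E.
Proof.
apply: le_ereal_inf_tmp => _ [U _ <-]; apply: nneseries_ge0 => i _ _.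
exact: diam_pow_ge0.
Qed.

(** This is what makes a lower bound for exponent 1 a lower bound for every
smaller exponent. *)
Lemma diam_le_diam_pow {R : realType} {T : Type} (d : T -> T -> R) s
  (U : set T) : (forall p q, 0 <= d p q) -> 0 <= s <= 1 ->
  (U !=set0)%classic -> (diam d U <= 1)%E -> (diam d U <= diam_pow d s U)%E.
Proof.
move=> d0 /andP[s0 s1] U0 U1; rewrite /diam_pow asboolF; last exact/eqP/set0P.
move: (@diam_ge0 _ _ d U d0 U0) U1; case: (diam d U) => [r| |]//.
rewrite !lee_fin => r0 r1.
have [->|rn0] := eqVneq r 0; first exact: powR_ge0.
by rewrite ger1_powR// lt_neqAle eq_sym rn0 r0 r1.
Qed.

(** A finite cover is padded with empty sets, which cost nothing since they
contribute 0 for every exponent. *)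
Lemma hausdorff_content_finite_cover {R : realType} {T : Type}
  (d : T -> T -> R) (s delta e : R) (A : set T) (U : nat -> set T) n :
  0 <= s -> 0 <= e <= delta -> (forall p q, 0 <= d p q) ->
  (A `<=` \bigcup_i U i)%classic ->
  (forall i, (n <= i)%N -> U i = set0) ->
  (forall i p q, U i p -> U i q -> d p q <= e) ->
  (hausdorff_content d s delta A <= (n%:R * e `^ s)%:E)%E.
Proof.
move=> s0 /andP[e0 ed] d0 AU Un dU.
have diamU i : (diam d (U i) <= e%:E)%E.
  apply: ge_ereal_sup => _ [[p q] [/= Up Uq] <-]; rewrite lee_fin.
  exact: dU Up Uq.
apply: (@le_trans _ _ (\sum_(0 <= i <oo) diam_pow d s (U i))%E).
  apply: ereal_inf_lbound; exists U => //; split=> // i.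
  by apply: le_trans (diamU i) _; rewrite lee_fin.
rewrite (@nneseries_split _ _ 0 n); last by move=> i _; exact: diam_pow_ge0.
rewrite add0n eseries0 ?adde0; last first.
  by move=> i ni _; rewrite /diam_pow asboolT// Un.
apply: (@le_trans _ _ (\sum_(0 <= i < n) (e `^ s)%:E)%E).
  apply: lee_sum => i _; rewrite /diam_pow; case: asboolP => [_|/eqP/set0P U0].
    by rewrite lee_fin powR_ge0.
  have dU0 := @diam_ge0 _ _ d (U i) d0 U0.
  rewrite -poweR_EFin gt0_ler_poweR//.
  - by rewrite in_itv/= dU0 leey.
  - by rewrite in_itv/= lee_fin e0 leey.
by rewrite sumEFin lee_fin sumr_const_nat subn0 mulr_natl.
Qed.

(** * Graphs over the unit interval *)

(** The projection to the first axis does not increase distances. Each piece of a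
cover is projected into an interval centred at one of its points, of length twice
the diameter; this factor 2 is why the bound is 1/2, and any positive bound is
enough to bound the dimension. *)
Lemma hausdorff_content_graph01_ge {R : realType} (f : R -> R) s :
  0 <= s <= 1 ->
  ((1 / 2)%:E <= hausdorff_content (@euclid_dist R) s 1 (graph01 f))%E.
Proof.
move=> s01; apply: le_ereal_inf_tmp => _ [U [fU U1] <-].
pose D i := fine (diam (@euclid_dist R) (U i)).
(* The measure bound is stated for a cover of the projection by measurable sets,
   so that an empty piece can be given the empty set. *)
have I_ex i : exists J : set R, [/\ measurable J,
    (forall p, U i p -> J p.1) &
    (lebesgue_measure J <= 2%:E * diam_pow (@euclid_dist R) s (U i))%E].
  have [->|/set0P U0] := eqVneq (U i) set0.
    exists set0; split => //; rewrite measure0 mule_ge0 ?diam_pow_ge0//.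
  have dU := @diam_ge0 _ _ _ (U i) (@euclid_dist_ge0 R) U0.
  have := @diam_le_diam_pow _ _ _ s (U i) (@euclid_dist_ge0 R) s01 U0 (U1 i).
  have [p Up] := U0.
  have DE : diam (@euclid_dist R) (U i) = (D i)%:E.
    rewrite /D fineK// ge0_fin_numE//; exact: le_lt_trans (U1 i) (ltry _).
  move: dU; rewrite DE lee_fin => D0 DP.
  exists `[p.1 - D i, p.1 + D i]%classic; split => //.
    move=> q Uq /=; rewrite in_itv/= -ler_distlC distrC.
    apply: (le_trans (normB_le_euclid_dist q p)).
    by rewrite -lee_fin -DE; apply: ereal_sup_ubound; exists (q, p).
  apply: (@le_trans _ _ (2%:E * (D i)%:E)%E); last by rewrite lee_pmul2l.
  rewrite lebesgue_measure_itv/= lte_fin; case: ifPn => _; last first.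
    by rewrite -EFinM lee_fin mulr_ge0.
  by rewrite -EFinB -EFinM lee_fin; lra.
have [J JP] := choice I_ex.
have sub01 : (`[0%R, 1%R]%classic `<=` \bigcup_i J i)%classic.
  move=> x x01; have [|i _ Ui] := fU (x, f x); first by exists x.
  by exists i => //; have [_ /(_ _ Ui)] := JP i.
have le1 : (1%:E <= \sum_(0 <= i <oo) lebesgue_measure (J i))%E.
  rewrite (_ : 1%:E = lebesgue_measure `[0%R : R, 1%R]%classic)%E.
    by apply: measure_sigma_subadditive => // i; have [] := JP i.
  by rewrite lebesgue_measure_itv/= lte_fin ltr01 oppr0 adde0.
have : (1%:E <= 2%:E *
    \sum_(0 <= i <oo) diam_pow (@euclid_dist R) s (U i))%E.
  rewrite -nneseriesZl; last by move=> i _; exact: diam_pow_ge0.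
  apply: (le_trans le1); apply: lee_nneseries => // i _.
  by have [] := JP i.
have : (0 <= \sum_(0 <= i <oo) diam_pow (@euclid_dist R) s (U i))%E.
  by apply: nneseries_ge0 => i _ _; exact: diam_pow_ge0.
case: (\sum_(0 <= i <oo) _)%E => [r| |] //; last by move=> *; exact: leey.
by rewrite -EFinM !lee_fin => r0 r1; lra.
Qed.

(** The pieces are the level sets of the integer part of [N * (x + f x - f 0)].
For two points of a nondecreasing graph the differences of [x] and of [f x] have
the same sign, so the sum of their absolute values is the difference of [x + f x],
which is at most [1 / N] on a piece. The number of pieces is at most
[N * (f 1 - f 0 + 1) + 1], hence at most [N * (f 1 - f 0 + 2)]. *)
Lemma hausdorff_content_graph01_le {R : realType} (f : R -> R) s delta
    (N : nat) :
  {in `[0, 1] &, nondecreasing_fun f} -> 0 <= s -> (0 < N)%N ->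
  N%:R^-1 <= delta ->
  (hausdorff_content (@euclid_dist R) s delta (graph01 f) <=
   ((f 1 - f 0 + 2) * N%:R `^ (1 - s))%:E)%E.
Proof.
move=> fnd s0 N0 Nd.
have N0' : 0 < N%:R :> R by rewrite ltr0n.
have N1 : 1 <= N%:R :> R by rewrite ler1n.
have z01 : (0 : R) \in `[0, 1] by rewrite in_itv/= lexx ler01.
have o01 : (1 : R) \in `[0, 1] by rewrite in_itv/= lexx ler01.
have f01 : f 0 <= f 1 by exact: fnd.
pose h (p : R * R) := N%:R * (p.1 + p.2 - f 0).
pose U i := [set p | graph01 f p /\ Num.truncn (h p) = i]%classic.
have hge0 p : graph01 f p -> 0 <= h p.
  move=> [x x01 <-]; rewrite /h mulr_ge0//=.
  have fx : f 0 <= f x by apply: fnd => //; move: x01; rewrite /= in_itv/= => /andP[].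
  by move: x01; rewrite /= in_itv/= => /andP[x0 x1]; lra.
have hle p : graph01 f p -> h p <= N%:R * (f 1 - f 0 + 1).
  move=> [x x01 <-]; rewrite /h ler_wpM2l//=.
  have fx : f x <= f 1 by apply: fnd => //; move: x01; rewrite /= in_itv/= => /andP[].
  by move: x01; rewrite /= in_itv/= => /andP[x0 x1]; lra.
set n := (Num.truncn (N%:R * (f 1 - f 0 + 1) : R)).+1.
apply: (@le_trans _ _ (n%:R * (N%:R^-1) `^ s)%:E).
  apply: (@hausdorff_content_finite_cover _ _ _ s delta _ _ U) => //.
  - by rewrite invr_ge0 ltW.
  - exact: euclid_dist_ge0.
  - by move=> p Gp; exists (Num.truncn (h p)).
  - move=> i ni; apply/seteqP; split=> // p [Gp hi]; move: ni.
    by rewrite -hi /n ltnNge le_truncn// hle.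
  move=> i p q [Gp pi] [Gq qi].
  apply: le_trans (euclid_dist_le_add p q) _.
  have /andP[p1 p2] := truncn_itv (hge0 p Gp).
  have /andP[q1 q2] := truncn_itv (hge0 q Gq).
  rewrite pi in p1 p2; rewrite qi in q1 q2.
  rewrite -(ler_pM2l N0') divff ?gt_eqF//.
  have : `|h p - h q| <= 1.
    by rewrite -natr1 in p2 q2; rewrite ler_norml; apply/andP; split; lra.
  apply: le_trans.
  have -> : h p - h q = N%:R * ((p.1 - q.1) + (p.2 - q.2)) by rewrite /h; ring.
  rewrite normrM (ger0_norm (ltW N0')) ler_wpM2l//.
  move: Gp Gq => [x x01 <-] [y y01 <-] /=.
  have [xy|/ltW yx] := leP x y.
    have fxy : f x <= f y by exact: fnd.
    rewrite !ler0_norm; lra.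
  have fyx : f y <= f x by exact: fnd.
  rewrite !ger0_norm; lra.
rewrite lee_fin.
have -> : N%:R `^ (1 - s) = N%:R * (N%:R^-1) `^ s :> R.
  rewrite -powR_inv1// -powRrM mulN1r powRD; last by rewrite (gt_eqF N0') implybT.
  by rewrite powRr1.
rewrite mulrA ler_wpM2r ?powR_ge0//.
have : (Num.truncn (N%:R * (f 1 - f 0 + 1) : R))%:R <= N%:R * (f 1 - f 0 + 1).
  by rewrite truncn_le mulr_ge0//; lra.
by rewrite /n -natr1; lra.
Qed.

Lemma hausdorff_measure_graph01_eq0 {R : realType} (f : R -> R) s :
  {in `[0, 1] &, nondecreasing_fun f} -> 1 < s ->
  hausdorff_measure (@euclid_dist R) s (graph01 f) = 0%E.
Proof.
move=> fnd s1; have s0 : 0 <= s by lra.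
have s1' : 0 < s - 1 by lra.
have f01 : f 0 <= f 1.
  by apply: fnd; rewrite ?in_itv/= ?lexx ler01.
apply/eqP; rewrite eq_le; apply/andP; split; last first.
  apply: (le_trans (hausdorff_content_ge0 (@euclid_dist R) s 1 (graph01 f))).
  by apply: ereal_sup_ubound; exists 1 => //=.
apply: ge_ereal_sup => _ [delta /= d0 <-].
apply/lee_addgt0Pr => e e0; rewrite add0e.
pose C := f 1 - f 0 + 2.
have C0 : 0 < C by rewrite /C; lra.
(* The first bound makes the pieces smaller than [delta], the second makes
   [C * N `^ (1 - s)] at most [e]. *)
pose x := Num.max delta^-1 ((C / e) `^ (s - 1)^-1).
pose N := (Num.truncn x).+1.
have xN : x < N%:R by exact: truncnS_gt.
have /andP[dN CN] : (delta^-1 <= N%:R) && ((C / e) `^ (s - 1)^-1 <= N%:R).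
  by rewrite -ge_max ltW.
apply: (le_trans (@hausdorff_content_graph01_le _ f s delta N fnd s0 _ _)) => //.
  by rewrite -(invrK delta) lef_pV2 ?posrE ?invr_gt0// ltr0n.
rewrite lee_fin -/C -(opprB s 1) powRN.
have CNs : C / e <= N%:R `^ (s - 1).
  have Ce0 : 0 <= C / e by rewrite divr_ge0// ltW.
  have -> : C / e = ((C / e) `^ (s - 1)^-1) `^ (s - 1).
    by rewrite -powRrM mulVf ?gt_eqF// powRr1.
  by rewrite ge0_ler_powR ?nnegrE ?powR_ge0// ltW.
by rewrite ler_pdivrMr ?powR_gt0 ?ltr0n// mulrC -ler_pdivrMr.
Qed.

Lemma hausdorff_dim_graph01 {R : realType} (f : R -> R) :
  {in `[0, 1] &, nondecreasing_fun f} ->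
  hausdorff_dim (@euclid_dist R) (graph01 f) = 1%E.
Proof.
move=> fnd; apply/eqP; rewrite eq_le; apply/andP; split.
  apply/lee_addgt0Pr => e e0; rewrite -EFinD.
  apply: ereal_inf_lbound; exists (1 + e) => //; split; first lra.
  by apply: hausdorff_measure_graph01_eq0 => //; lra.
apply: le_ereal_inf_tmp => _ [s [s0 sH] <-]; rewrite lee_fin leNgt.
apply/negP => s1.
have s01 : 0 <= s <= 1 by rewrite s0 ltW.
have := @hausdorff_content_graph01_ge _ f s s01.
have : (hausdorff_content (@euclid_dist R) s 1 (graph01 f) <= 0)%E.
  by rewrite -sH; apply: ereal_sup_ubound; exists 1 => //=.
by move=> /[swap] /le_trans /[apply]; rewrite lee_fin; lra.
Qed.

(** * Monotonicity of the Okamoto function *)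

(** An increment at level [i.+1] is [a] or [1 - 2 * a] times an increment at level
[i]; for [0 < a <= 1 / 2] both factors lie between 0 and [1 - a]. *)
Lemma okamoto_node_increment {R : realType} (a : R) i k :
  0 < a <= 1 / 2 ->
  0 <= okamoto_node a i k.+1 - okamoto_node a i k <= (1 - a) ^+ i.
Proof.
move=> /andP[a0 a12].
elim: i k => [|i IH] k; first by rewrite /= -natr1 expr0; lra.
have -> : k.+1 = ((k %/ 3) * 3 + (k %% 3).+1)%N by rewrite addnS -divn_eq.
have -> : okamoto_node a i.+1 k =
    okamoto_node a i.+1 ((k %/ 3) * 3 + (k %% 3))%N by rewrite -divn_eq.
have := @ltn_pmod k 3 isT; case: (k %% 3)%N => [|[|[|//]]] _;
  rewrite /= ?divnMDl// ?modnMDl /= ?addn0 ?addn1 exprS;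
  move: (IH (k %/ 3)%N); move: (okamoto_node a i _.+1) => v;
  move: (okamoto_node a i _) ((1 - a) ^+ i) => u w /andP[D0 D1];
  have := mulr_ge0 (ltW a0) D0;
  have : 0 <= (1 - 2 * a) * (v - u) by rewrite mulr_ge0//; lra.
all: have : 0 <= (1 - a) * (w - (v - u)) by rewrite mulr_ge0 ?subr_ge0//; lra.
all: by move=> p1 p2 p3; apply/andP; split; lra.
Qed.

Lemma okamoto_node_homo {R : realType} (a : R) i : 0 < a <= 1 / 2 ->
  {homo okamoto_node a i : k l / (k <= l)%N >-> k <= l}.
Proof.
move=> ha; apply: homo_leq => // [y x z|k]; first exact: le_trans.
by have /andP[] := @okamoto_node_increment R a i k ha; rewrite subr_ge0.
Qed.

Lemma okamoto_node_coarse {R : realType} (a : R) i k :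
  okamoto_node a i.+1 (3 * k) = okamoto_node a i k.
Proof. by rewrite /= mulKn// modnMr. Qed.

Lemma okamoto_node_end {R : realType} (a : R) i : okamoto_node a i (3 ^ i) = 1.
Proof. by elim: i => // i IH; rewrite expnS okamoto_node_coarse. Qed.

(** The value of [f_i] at the left end of the triadic interval of level [i]
containing [x]; unlike [okamoto_f a i x] in general, it is nondecreasing in [i]. *)
Definition okamoto_lower {R : realType} (a : R) i (x : R) : R :=
  okamoto_node a i (Num.truncn (3 ^+ i * x)).

Lemma okamoto_lower_homo {R : realType} (a : R) i : 0 < a <= 1 / 2 ->
  {homo okamoto_lower a i : x y / x <= y}.
Proof.
move=> ha x y xy; apply/(okamoto_node_homo _ _ ha)/le_truncn.
by rewrite ler_wpM2l ?exprn_ge0.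
Qed.

Lemma okamoto_lower_cvg {R : realType} (a x : R) : 0 < a <= 1 / 2 ->
  0 <= x <= 1 -> cvgn (okamoto_lower a ^~ x).
Proof.
move=> ha /andP[x0 x1].
have y0 i : 0 <= 3 ^+ i * x by rewrite mulr_ge0 ?exprn_ge0.
(* The point [k / 3 ^+ i] is also the node of index [3 * k] at level [i.+1],
   so passing to the next level never moves the left end to the left. *)
apply: nondecreasing_is_cvgn.
  apply/nondecreasing_seqP => i; rewrite /okamoto_lower -okamoto_node_coarse.
  apply: okamoto_node_homo => //; rewrite truncn_ge_nat//.
  by rewrite natrM exprS -mulrA ler_wpM2l// truncn_le.
exists 1 => _ [i _ <-]; rewrite -(okamoto_node_end a i).
apply: okamoto_node_homo => //; rewrite -ltnS truncn_lt_nat//.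
rewrite -[ltRHS]natr1 natrX (@le_lt_trans _ _ (3 ^+ i))//; last by rewrite ltrDl.
by rewrite ler_piMr ?exprn_ge0.
Qed.

(** On its triadic interval of level [i], [f_i] rises above its value at the left
end by at most one increment, so by at most [(1 - a) ^+ i]. *)
Lemma okamoto_F_lower {R : realType} (a x : R) : 0 < a <= 1 / 2 ->
  0 <= x <= 1 -> okamoto_F a x = limn (okamoto_lower a ^~ x).
Proof.
move=> ha x01; have Lc := @okamoto_lower_cvg R a x ha x01.
have /andP[x0 _] := x01; have /andP[a0 a12] := ha.
apply/cvg_lim => //.
apply: (@squeeze_cvgr _ _ _ _ (okamoto_lower a ^~ x)
  (fun i => okamoto_lower a i x + geometric 1 (1 - a) i)) => //.
  apply: nearW => i; rewrite /okamoto_f /geometric/= mul1r.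
  have y0 : 0 <= 3 ^+ i * x by rewrite mulr_ge0 ?exprn_ge0.
  have /andP[t0] := truncn_itv y0; rewrite -[ltRHS]natr1 => t1.
  have := @okamoto_node_increment R a i (Num.truncn (3 ^+ i * x)) ha.
  rewrite -/(okamoto_lower a i x); move: t0 t1.
  move: (Num.truncn _)%:R (okamoto_node _ _ _.+1) => k v.
  move: (3 ^+ i * x) (okamoto_lower a i x) ((1 - a) ^+ i).
  move=> y l w t0 t1 /andP[D0 D1].
  have T0 : 0 <= (y - k) * (v - l) by rewrite mulr_ge0// subr_ge0.
  have T1 : 0 <= (1 - (y - k)) * (v - l) by rewrite mulr_ge0//; lra.
  by apply/andP; split; lra.
rewrite -[X in (_ --> X)%classic]addr0; apply: cvgD => //.
by apply: cvg_geometric; rewrite ger0_norm; lra.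
Qed.

Lemma okamoto_F_nondecreasing {R : realType} (a : R) : 0 < a <= 1 / 2 ->
  {in `[0, 1] &, nondecreasing_fun (okamoto_F a)}.
Proof.
move=> ha x y; rewrite !in_itv/= => x01 y01 xy.
rewrite !okamoto_F_lower//; apply: ler_lim; [exact: okamoto_lower_cvg..|].
by apply: nearW => i; exact: okamoto_lower_homo.
Qed.

Theorem theorem3 (R : realType) (a : R) (ha0 : 0 < a) (ha1 : a <= 1 / 2) :
  hausdorff_dim (@euclid_dist R) (okamoto_graph a) = 1%E.
Proof.
apply: hausdorff_dim_graph01; apply: okamoto_F_nondecreasing.
by rewrite ha0 ha1.
Qed.
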